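(* Let $L$ be an effect algebra, $G$ a complete Hausdorff (commutative) topological group and $\mu:L\to G$ a measure. Then: (1) $\mu$ is strongly additive if and only if $\mu$ is exhaustive. (2) If $G=\mathbb{R}$, then $\mu$ is absolutely additive if and only if $\mu$ is strongly additive. Moreover (for $G=\mathbb{R}$), if $\mu$ is bounded, then $\mu$ is exhaustive.
   Context: An effect algebra $(L,\oplus,0,1)$ is a set $L$ with elements $0,1\in L$ and a partial binary operation $\oplus$ such that for all $p,q,r\in L$: (E1) if $p\oplus q$ is defined then $q\oplus p$ is defined and equal to it; (E2) if $q\oplus r$ and $p\oplus(q\oplus r)$ are defined then $p\oplus q$ and $(p\oplus q)\oplus r$ are defined and $(p\oplus q)\oplus r=p\oplus(q\oplus r)$; (E3) for every $p$ there is a unique $q$ with $p\oplus q=1$; (E4) if $1\oplus p$ is defined then $p=0$. Elements $p,q$ are orthogonal if $p\oplus q$ is defined. Finite orthosums are defined inductively by $a_1\oplus\dots\oplus a_n=(a_1\oplus\dots\oplus a_{n-1})\oplus a_n$ when the right side exists (independent of the order). A sequence $(a_n)_{n\in\mathbb{N}}$ in $L$ is orthogonal if for every finite set $F$ of indices the orthosum $\bigoplus_{n\in F}a_n$ exists. All groups are commutative and additive. A map $\mu:L\to G$ is a measure if $\mu(a\oplus b)=\mu(a)+\mu(b)$ for all orthogonal $a,b\in L$. A measure $\mu$ is: strongly additive if $\sum_{n}\mu(a_n)$ converges for every orthogonal sequence $(a_n)$; exhaustive if $\lim_n\mu(a_n)=0$ for every orthogonal sequence $(a_n)$; (for $G=\mathbb{R}$)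 absolutely additive if $\sum_n|\mu(a_n)|<+\infty$ for every orthogonal sequence $(a_n)$; bounded if $\sup\{|\mu(a)|:a\in L\}<+\infty$. *)

(* Defs.v *)
From mathcomp Require Import all_boot all_order all_algebra finmap.
From mathcomp Require Import all_classical all_reals all_analysis.

Set Implicit Arguments.
Unset Strict Implicit.
Unset Printing Implicit Defensive.

Import Order.TTheory GRing.Theory Num.Theory.
Import numFieldNormedType.Exports.

Local Open Scope classical_set_scope.
Local Open Scope ring_scope.

(* [oplus p q = None] means that the partial sum of p and q is undefined. *)
Record effectAlgebra := EffectAlgebra {
  ea_sort :> Type;
  ea0 : ea_sort;
  ea1 : ea_sort;
  oplus : ea_sort -> ea_sort -> option ea_sort;
  oplusC : forall p q s, oplus p q = Some s -> oplus q p = Some s;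
  oplusA : forall p q r s t, oplus q r = Some s -> oplus p s = Some t ->
    exists2 u, oplus p q = Some u & oplus u r = Some t;
  oplus_compl : forall p, exists! q, oplus p q = Some ea1;
  oplus1_eq0 : forall p s, oplus ea1 p = Some s -> p = ea0
}.

Section EffectAlgebra.
Variable L : effectAlgebra.

(* Left-nested sum ((a1 + a2) + ...) + an, with the value 0 on the empty list. *)
Definition orthosum (s : seq L) : option L :=
  if s is a :: s' then
    foldl (fun x b => obind (fun y => oplus y b) x) (Some a) s'
  else Some (ea0 L).

(* The sum is taken along the enumeration of F provided by finmap; neither its
   existence nor its value depends on the order. *)
Definition orthogonal_seq (a : nat -> L) : Prop :=
  forall F : {fset nat},
    exists s, orthosum [seq a n | n <- enum_fset F] = Some s.

Definition is_measure (G : zmodType) (mu : L -> G) : Prop :=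
  forall a b c, oplus a b = Some c -> mu c = mu a + mu b.

Definition strongly_additive (G : topologicalZmodType) (mu : L -> G) : Prop :=
  forall a, orthogonal_seq a ->
    exists l : G, series (fun n => mu (a n)) @ \oo --> l.

Definition exhaustive (G : topologicalZmodType) (mu : L -> G) : Prop :=
  forall a, orthogonal_seq a -> mu (a n) @[n --> \oo] --> (0 : G).

Definition absolutely_additive (R : realType) (mu : L -> R) : Prop :=
  forall a, orthogonal_seq a ->
    (\sum_(0 <= n <oo) `|mu (a n)|%:E < +oo)%E.

Definition bounded_measure (R : realType) (mu : L -> R) : Prop :=
  (ereal_sup [set `|mu a|%:E | a in [set: L]] < +oo)%E.

End EffectAlgebra.

(* The canonical uniformity of a commutative topological group. *)
Definition group_entourage (G : topologicalZmodType) : set_system (G * G) :=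
  [set E | exists2 U : set G, nbhs 0 U & forall x y, U (x - y) -> E (x, y)].

Definition group_cauchy (G : topologicalZmodType) (F : set_system G) : Prop :=
  (F, F) --> @group_entourage G.

Definition complete_group (G : topologicalZmodType) : Prop :=
  forall F : set_system G, ProperFilter F -> group_cauchy F ->
    exists l : G, F --> l.

(* Main.v *)
From HB Require Import structures.
Require Import Defs.
From mathcomp Require Import all_boot all_order all_algebra finmap.
From mathcomp Require Import all_classical all_reals all_analysis.
Import numFieldNormedType.Exports.
Import Order.TTheory GRing.Theory Num.Theory.

Set Implicit Arguments.
Unset Strict Implicit.
Unset Printing Implicit Defensive.

Local Open Scope classical_set_scope.
Local Open Scope ring_scope.

(** With [None] as an absorbing "undefined" element, the partial sum of an
    effect algebra [L] becomes a commutative monoid law on [option L], so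
    orthosums can be regrouped and reordered freely. If the series of an
    orthogonal sequence is not Cauchy, then the orthosums of disjoint blocks of
    its terms form an orthogonal sequence along which the measure does not tend
    to [0]. For a real measure, replacing by [0] the terms of an orthogonal
    sequence on which the measure has a given sign keeps the sequence
    orthogonal; so if the partial sums along every orthogonal sequence are
    bounded, then the positive and negative parts are separately summable. *)

(** * Orthosums in a commutative monoid *)

Section PartialSum.
Variable L : effectAlgebra.
Implicit Types (p q r : L) (x y z : option L) (a : nat -> L).

Lemma compl_inj p q r :
  oplus p r = Some (ea1 L) -> oplus q r = Some (ea1 L) -> p = q.
Proof.
move=> /oplusC pr /oplusC qr; have [s [_ s_uniq]] := oplus_compl r.
by rewrite -(s_uniq _ pr) (s_uniq _ qr).
Qed.

(** If [q] is the complement of [p], associativity turns 0 + (p + q) = 1 into (0 + p) + q = 1, so 0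
    + p and p have the same complement. *)
Lemma oplus0p p : oplus (ea0 L) p = Some p.
Proof.
have [z [one_z _]] := oplus_compl (ea1 L).
have [q [pq _]] := oplus_compl p.
move: (one_z); rewrite (oplus1_eq0 one_z) => /oplusC zero_one.
have [u -> uq] := oplusA pq zero_one.
by rewrite (compl_inj uq pq).
Qed.

Lemma oplus_comm p q : oplus p q = oplus q p.
Proof.
case pq: (oplus p q) => [s|]; first by rewrite (oplusC pq).
by case qp: (oplus q p) => [s|//]; rewrite (oplusC qp) in pq.
Qed.

Definition oadd x y : option L := obind (fun p => obind (oplus p) y) x.

Lemma oaddC : commutative oadd.
Proof. by case=> [p|] [q|] //=; exact: oplus_comm. Qed.

Lemma oadd0x : left_id (Some (ea0 L)) oadd.
Proof. by case=> //= p; rewrite oplus0p. Qed.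

Lemma oaddA_Some x y z p :
  oadd x (oadd y z) = Some p -> oadd (oadd x y) z = Some p.
Proof.
case: x y z => [x|] [y|] [z|] //=.
case yz: (oplus y z) => [s|//] /= xs.
by have [u -> /= ->] := oplusA yz xs.
Qed.

Lemma oaddA : associative oadd.
Proof.
move=> x y z.
case xyz: (oadd x (oadd y z)) => [p|]; first by rewrite (oaddA_Some xyz).
case zyx: (oadd (oadd x y) z) => [p|//].
(* Commutativity reverses the bracketing, so [oaddA_Some] also rules out that only the right-hand
   side is defined. *)
move: zyx; rewrite oaddC (oaddC x) => /oaddA_Some.
by rewrite oaddC (oaddC z) xyz.
Qed.

HB.instance Definition _ :=
  Monoid.isComLaw.Build (option L) (Some (ea0 L)) oadd oaddA oaddC oadd0x.

Lemma orthosumE (s : seq L) :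
  orthosum s = \big[oadd/Some (ea0 L)]_(p <- s) Some p.
Proof.
case: s => [|p s]; first by rewrite big_nil.
rewrite big_cons /orthosum; elim: s (Some p) => [|q s IHs] x.
  by rewrite big_nil oaddC oadd0x.
by rewrite big_cons oaddA -IHs.
Qed.

(** Commutativity makes the enumeration of a finite set irrelevant; duplicate-free lists are easier
    to filter and concatenate. *)
Lemma orthogonal_seqP a :
  orthogonal_seq a <->
  (forall s : seq nat, uniq s ->
     exists p, \big[oadd/Some (ea0 L)]_(n <- s) Some (a n) = Some p).
Proof.
split=> [orth s s_uniq|orth F].
  have [p] := orth (seq_fset tt s).
  rewrite orthosumE big_map => pE; exists p; rewrite -pE.
  apply: perm_big; rewrite perm_sym (perm_trans (seq_fset_perm tt s)) //.
  by rewrite undup_id.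
by have [p pE] := orth _ (fset_uniq F); exists p; rewrite orthosumE big_map.
Qed.

(** As 0 is neutral, the new sum over [s] is the sum of [a] over the filtered list. *)
Lemma orthogonal_seq_restrict a (P : pred nat) :
  orthogonal_seq a ->
  orthogonal_seq (fun n => if P n then a n else ea0 L).
Proof.
move=> /orthogonal_seqP orth; apply/orthogonal_seqP => s s_uniq.
have [p pE] := orth _ (filter_uniq P s_uniq); exists p; rewrite -pE.
by rewrite big_filter [RHS]big_mkcond; apply: eq_bigr => n _; case: (P n).
Qed.

Lemma uniq_flatten (I J : eqType) (f : I -> seq J) (s : seq I) :
  uniq s -> (forall i, uniq (f i)) ->
  (forall i k j, j \in f i -> j \in f k -> i = k) ->
  uniq (flatten [seq f i | i <- s]).
Proof.
move=> + f_uniq f_disj; elim: s => //= i s IHs /andP[i_notin s_uniq].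
rewrite cat_uniq f_uniq IHs //= andbT; apply/hasPn => j /flattenP[t].
move=> /mapP[k ks ->] jk; apply: contra i_notin => ji.
by rewrite (f_disj _ _ _ ji jk).
Qed.

(** Concatenating disjoint blocks gives a duplicate-free list, over which the sum of [a] exists. *)
Lemma orthogonal_seq_blocks a (b : nat -> L) (f : nat -> seq nat) :
  orthogonal_seq a -> (forall k, uniq (f k)) ->
  (forall i k j, j \in f i -> j \in f k -> i = k) ->
  (forall k, \big[oadd/Some (ea0 L)]_(n <- f k) Some (a n) = Some (b k)) ->
  orthogonal_seq b.
Proof.
move=> /orthogonal_seqP orth f_uniq f_disj bE.
apply/orthogonal_seqP => s s_uniq.
have [p pE] := orth _ (uniq_flatten s_uniq f_uniq f_disj); exists p; rewrite -pE.
by rewrite big_flatten big_map; apply: eq_bigr => k _; rewrite bE.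
Qed.

End PartialSum.

Section Measure.
Variables (L : effectAlgebra) (G : zmodType) (mu : L -> G).
Hypothesis mu_measure : is_measure mu.

Lemma measure_ea0 : mu (ea0 L) = 0.
Proof.
have /mu_measure/eqP := oplus0p (ea0 L).
by rewrite -subr_eq subrr eq_sym => /eqP.
Qed.

Lemma measure_bigoadd (a : nat -> L) (s : seq nat) (p : L) :
  \big[@oadd L/Some (ea0 L)]_(n <- s) Some (a n) = Some p ->
  mu p = \sum_(n <- s) mu (a n).
Proof.
elim: s p => [|n s IHs] p; first by rewrite !big_nil => -[<-]; exact: measure_ea0.
rewrite !big_cons; case: (bigop _ _ _) IHs => [q|//] IHs /= /mu_measure ->.
by rewrite (IHs q).
Qed.

End Measure.

(** * Strong additivity and exhaustivity in topological groups *)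

Section TopologicalGroup.
Variables (L : effectAlgebra) (G : topologicalZmodType) (mu : L -> G).

Lemma cvg_series_cvg0 (u : nat -> G) (l : G) :
  series u @ \oo --> l -> u @ \oo --> (0 : G).
Proof.
move=> ul.
have uE : u = fun n => series u n.+1 - series u n.
  by apply/funext => n; rewrite sub_series_geq // big_nat1.
rewrite uE -(subrr l).
apply: (@continuous2_cvg _ _ _ _ _ _ _ _ (fun x y : G => x - y)) => //.
  exact: (@sub_continuous G (l, l)).
move=> U /ul[N _ NU]; exists N => // n /= Nn; apply: NU => /=; exact: leqW.
Qed.

Lemma strongly_additive_exhaustive : strongly_additive mu -> exhaustive mu.
Proof. by move=> sa a /sa[l]; exact: cvg_series_cvg0. Qed.

Lemma complete_group_cvg_series (u : nat -> G) :
  complete_group G ->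
  (forall U, nbhs (0 : G) U -> exists N, forall n m,
     (N <= n)%N -> (n <= m)%N -> U (\sum_(n <= k < m) u k)) ->
  exists l : G, series u @ \oo --> l.
Proof.
move=> compl cauchy; apply: compl => E [U U0 UE].
(* A difference of partial sums is a block sum up to a sign that depends on which index is larger,
   so [U] is intersected with its negative. *)
have U0' : nbhs (0 : G) (-%R @^-1` U).
  by apply: (@opp_continuous G 0); rewrite oppr0.
have [N NU] := cauchy _ (filterI U0 U0').
exists (series u @` [set n | (N <= n)%N], series u @` [set n | (N <= n)%N]).
  by split; exists N => // n /= Nn; exists n.
move=> [_ _] /= [[n Nn <-] [m Nm <-]]; apply: UE; rewrite sub_series.
have [mn|/ltnW nm] := leqP m n.
  by have [] := NU _ _ Nm mn.
by have [] := NU _ _ Nn nm.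
Qed.

Lemma exhaustive_strongly_additive :
  complete_group G -> is_measure mu -> exhaustive mu -> strongly_additive mu.
Proof.
move=> compl mu_meas exh a orth; apply: complete_group_cvg_series => // U U0.
apply: contrapT => /forallNP not_cauchy.
(* [f N] gives the ends of a block beyond [N] whose sum lies outside [U]. *)
have /choice[f fP] : forall N, exists nm : nat * nat,
    [/\ (N <= nm.1)%N, (nm.1 <= nm.2)%N &
        ~ U (\sum_(nm.1 <= k < nm.2) mu (a k))].
  move=> N; have := not_cauchy N.
  move=> /existsNP[n /existsNP[m]] /not_implyP[Nn /not_implyP[nm nU]].
  by exists (n, m).
(* The block chosen from [g k] ends at [g k.+1], where the search for the next one starts; this
   makes the blocks disjoint. *)
pose g k := iter k (fun N => (f N).2) 0%N.
have gS k : (g k <= g k.+1)%N.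
  by have [le1 le2 _] := fP (g k); exact: leq_trans le2.
have g_homo : {homo g : i j / (i <= j)%N}.
  by apply: homo_leq => //; exact: leq_trans.
pose B k := index_iota (f (g k)).1 (f (g k)).2.
have B_g k n : n \in B k -> (g k <= n < g k.+1)%N.
  rewrite mem_index_iota => /andP[le_n lt_n]; rewrite lt_n andbT.
  by have [le1 _ _] := fP (g k); exact: leq_trans le_n.
have B_disj i k n : n \in B i -> n \in B k -> i = k.
  move=> /B_g/andP[gi ig] /B_g/andP[gk kg].
  case: (ltngtP i k) => // /g_homo le_g.
    by have := leq_trans (leq_trans ig le_g) gk; rewrite ltnn.
  by have := leq_trans (leq_trans kg le_g) gi; rewrite ltnn.
have /choice[b bE] k := (orthogonal_seqP a).1 orth (B k) (iota_uniq _ _).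
have b_orth : orthogonal_seq b.
  by apply: (orthogonal_seq_blocks orth _ B_disj bE) => k; exact: iota_uniq.
have [N _ NU] := exh _ b_orth _ U0.
have [_ _] := fP (g N); apply.
by rewrite -(measure_bigoadd mu_meas (bE N)); apply: NU => /=.
Qed.

End TopologicalGroup.

(** * Absolute additivity and boundedness of real measures *)

Section RealMeasure.
Variables (L : effectAlgebra) (R : realType) (mu : L -> R).
Hypothesis mu_measure : is_measure mu.

Lemma absolutely_additive_strongly_additive :
  absolutely_additive mu -> strongly_additive mu.
Proof.
move=> aa a /aa fin_sum; apply/cvg_ex; apply: normed_cvg.
apply: nondecreasing_is_cvgn.
  by apply: nondecreasing_series => n _ _; exact: normr_ge0.
(* [fine] keeps the value here, since the sum is nonnegative and finite by [fin_sum]. *)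
exists (fine (\sum_(0 <= n <oo) `|mu (a n)|%:E)%E) => _ [n _ <-].
rewrite -lee_fin fineK; last first.
  by rewrite ge0_fin_numE // nneseries_ge0 // => k _ _; rewrite lee_fin.
rewrite /series /= -sumEFin.
by apply: nneseries_lim_ge => k _ _; rewrite lee_fin.
Qed.

Lemma bounded_series_absolutely_additive :
  (forall a, orthogonal_seq a ->
     exists M, forall n, `|\sum_(0 <= k < n) mu (a k)| <= M) ->
  absolutely_additive mu.
Proof.
move=> bnd a orth.
pose c (P : pred nat) n := if P n then a n else ea0 L.
pose P n := 0 <= mu (a n).
have [M1 M1P] := bnd _ (orthogonal_seq_restrict P orth).
have [M2 M2P] := bnd _ (orthogonal_seq_restrict (predC P) orth).
apply: (@le_lt_trans _ _ (M1 + M2)%:E); last exact: ltry.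
apply: lime_le.
  by apply: is_cvg_nneseries => n _ _; rewrite lee_fin.
apply: nearW => n; rewrite sumEFin lee_fin.
(* For each [k] one of the two restricted terms is the measure of 0, hence 0, and the other is
   [mu (a k)], entering with its sign. *)
have -> : \sum_(0 <= k < n) `|mu (a k)| =
    \sum_(0 <= k < n) mu (c P k) - \sum_(0 <= k < n) mu (c (predC P) k).
  rewrite -sumrB; apply: eq_bigr => k _; rewrite /c /P /=.
  have [mu_ge0|mu_lt0] := lerP 0 (mu (a k)).
    by rewrite measure_ea0 // subr0 ger0_norm.
  by rewrite measure_ea0 // sub0r ltr0_norm.
apply: le_trans (ler_norm _) (le_trans (ler_normB _ _) _).
exact: lerD.
Qed.

Lemma strongly_additive_absolutely_additive :
  strongly_additive mu -> absolutely_additive mu.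
Proof.
move=> sa; apply: bounded_series_absolutely_additive => a /sa/cvg_ex.
(* [MP] makes every real strictly above [M] a bound, hence [M + 1]. *)
move=> /cvg_seq_bounded[M [_ MP]]; exists (M + 1) => n.
by apply: (MP (M + 1)) => //; rewrite ltrDl.
Qed.

(** Each partial sum is the measure of a single element, the orthosum of the first [n] terms, so the
    supremum bounds it. *)
Lemma bounded_measure_absolutely_additive :
  bounded_measure mu -> absolutely_additive mu.
Proof.
move=> mu_bnd; apply: bounded_series_absolutely_additive => a orth.
exists (fine (ereal_sup [set `|mu p|%:E | p in [set: L]])) => n.
have [p pE] := (orthogonal_seqP a).1 orth (index_iota 0 n) (iota_uniq _ _).
have le_sup : (`|mu p|%:E <= ereal_sup [set `|mu p|%:E | p in [set: L]])%E.
  by apply: ereal_sup_ubound; exists p.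
rewrite -(measure_bigoadd mu_measure pE) -lee_fin fineK //.
by rewrite ge0_fin_numE // (le_trans _ le_sup) ?lee_fin.
Qed.

End RealMeasure.

Theorem theorem2p1 (L : effectAlgebra) :
  (forall G : topologicalZmodType,
     hausdorff_space G -> complete_group G ->
     forall mu : L -> G, is_measure mu ->
       (strongly_additive mu <-> exhaustive mu)) /\
  (forall (R : realType) (mu : L -> R), is_measure mu ->
     (absolutely_additive mu <-> strongly_additive mu) /\
     (bounded_measure mu -> exhaustive mu)).
Proof.
split=> [G _ compl mu mu_meas|R mu mu_meas].
  split; first exact: strongly_additive_exhaustive.
  exact: exhaustive_strongly_additive.
split.
  split; first exact: absolutely_additive_strongly_additive.
  exact: strongly_additive_absolutely_additive.
move=> /(bounded_measure_absolutely_additive mu_meas).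
by move=> /absolutely_additive_strongly_additive/strongly_additive_exhaustive.
Qed.
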